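(* Let $N,T,n,d,l\ge 1$. For $i=1,\dots,N$ and $t=1,\dots,T$ let $A_i^t\in\mathbb{R}^{n\times n}$ be the adjacency matrix and $X_i^t\in\mathbb{R}^{l\times n}$ the node attribute matrix of the $t$-th snapshot of the dynamic graph $\mathcal{G}_i$. Let $W^1,\dots,W^T\in\mathbb{R}^{d\times d}$ and $V\in\mathbb{R}^{d\times l}$, and let $\sigma$ be an element-wise non-expansive function. If $$\|W^t\|_\infty\,\|A_i^t\|_{op}<1\qquad\text{for all } t=1,\dots,T \text{ and all } i=1,\dots,N,$$ then for every $i=1,\dots,N$ the coupled system of equilibrium equations $$Z_i^t=\sigma\big(W^t Z_i^{\tau(t)}A_i^t+VX_i^t\big),\qquad t=1,\dots,T,$$ has a unique solution $(Z_i^1,\dots,Z_i^T)\in(\mathbb{R}^{d\times n})^T$.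
   Context: A dynamic graph $\mathcal{G}_i=\{G_i^1,\dots,G_i^T\}$ is a sequence of $T$ snapshots on a common set of $n$ nodes; snapshot $G_i^t$ has an adjacency matrix $A_i^t$ and a node attribute matrix $X_i^t$. The parameters $W^t$ and $V$ are shared by all the dynamic graphs $\mathcal{G}_1,\dots,\mathcal{G}_N$. The cyclic index map $\tau:\{1,\dots,T\}\to\{1,\dots,T\}$ is $\tau(t)=t-1$ for $2\le t\le T$ and $\tau(1)=T$. An element-wise non-expansive function $\sigma$ is a function $\mathbb{R}\to\mathbb{R}$ with $|\sigma(x)-\sigma(y)|\le|x-y|$ for all $x,y$, applied to matrices entry by entry. $\|\cdot\|_{op}$ is the matrix operator norm induced by the Euclidean norm, and $\|W\|_\infty=\max_i\sum_j|W_{ij}|$ is the matrix infinity norm (maximum absolute row sum). *)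

(* Defs.v *)
From mathcomp Require Import all_boot all_order all_algebra.
From mathcomp Require Import all_classical all_reals.

Set Implicit Arguments.
Unset Strict Implicit.
Unset Printing Implicit Defensive.

Import Order.TTheory GRing.Theory Num.Theory.
Local Open Scope classical_set_scope.
Local Open Scope ring_scope.

Definition l2norm (R : realType) (n : nat) (x : 'cV[R]_n) : R :=
  Num.sqrt (\sum_(i < n) x i 0 ^+ 2).

Definition opnorm (R : realType) (m n : nat) (A : 'M[R]_(m, n)) : R :=
  sup [set l2norm (A *m x) | x in [set x : 'cV[R]_n | l2norm x <= 1]].

(* The base value 0 of the maximum is harmless: every row sum is nonnegative. *)
Definition infnorm (R : realType) (m n : nat) (W : 'M[R]_(m, n)) : R :=
  \big[Num.max/0]_(i < m) \sum_(j < n) `|W i j|.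

Definition nonexpansive (R : realType) (s : R -> R) : Prop :=
  forall x y : R, `|s x - s y| <= `|x - y|.

(* Indices are 0-based: the time steps 1, .., T are the elements 0, .., T-1 of
   'I_T, so that ord_pred sends t to t-1 for t > 0 and 0 to T-1. *)
Definition tau (T : nat) (t : 'I_T) : 'I_T := ord_pred t.

Lemma tauE (T : nat) (t : 'I_T) :
  tau t = (if t == 0 :> nat then T.-1 else t.-1) :> nat.
Proof.
case: T t => [|T] [[|t] lt_t] //=; first by rewrite modn_small.
by rewrite modnDr modn_small // ltnW.
Qed.

Definition equilibrium (R : realType) (T n d l : nat) (s : R -> R)
    (W : 'I_T -> 'M[R]_d) (V : 'M[R]_(d, l))
    (A : 'I_T -> 'M[R]_n) (X : 'I_T -> 'M[R]_(l, n))
    (Z : {ffun 'I_T -> 'M[R]_(d, n)}) : Prop :=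
  forall t : 'I_T,
    Z t = map_mx s (W t *m Z (tau t) *m A t + V *m X t).

(* The supremum defining opnorm is that of a nonempty bounded set, so it never
   takes the default value of sup. *)
Lemma opnorm_has_sup (R : realType) (m n : nat) (A : 'M[R]_(m, n)) :
  has_sup [set l2norm (A *m x) | x in [set x : 'cV[R]_n | l2norm x <= 1]].
Proof.
split.
  exists (l2norm (A *m 0)), 0 => //=.
  rewrite /l2norm big1 ?sqrtr0 ?ler01 // => i _.
  by rewrite mxE expr0n.
exists (Num.sqrt (\sum_(i < m) (\sum_(j < n) `|A i j|) ^+ 2)) => _ [x /= x1 <-].
rewrite ler_wsqrtr //; apply: ler_sum => i _.
rewrite -[leLHS]real_normK ?num_real // lerXn2r ?nnegrE ?sumr_ge0 //.
rewrite mxE (le_trans (ler_norm_sum _ _ _)) //; apply: ler_sum => j _.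
rewrite normrM ler_piMr //; apply: le_trans x1.
rewrite -sqrtr_sqr ler_wsqrtr // (bigD1 j) //= lerDl sumr_ge0 // => k _.
exact: sqr_ge0.
Qed.

(* Main.v *)
(** Let |M| be the largest Euclidean norm of a row of M.  Rows of W M are
    combinations of the rows of M whose coefficients have absolute sum at most
    ||W||_oo, and right multiplication by A scales the Euclidean norm of a row by
    at most ||A||_op (the operator norms of A and A^T agree), so that
    |W M A| <= ||W||_oo ||A||_op |M|.  Applying a non-expansive function entry by
    entry does not increase |M - M'|.  Hence, for the distance
    max_t |Z^t - Z'^t|, the right-hand side of the system is a contraction of
    ratio max_t ||W^t||_oo ||A^t||_op < 1: the cyclic shift only permutes the
    components. *)

Require Import Defs.
From mathcomp Require Import all_boot all_order all_algebra.
From mathcomp Require Import all_classical all_reals.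
From mathcomp Require Import topology normedtype sequences.
From mathcomp Require Import ring lra.

Set Implicit Arguments.
Unset Strict Implicit.
Unset Printing Implicit Defensive.

Import Order.TTheory GRing.Theory Num.Theory.
Import numFieldNormedType.Exports.
Local Open Scope classical_set_scope.
Local Open Scope ring_scope.

(** * Euclidean norm, Cauchy-Schwarz, and the operator norms of [A] and [A^T] *)

Section L2norm.
Variable R : realType.

Lemma l2norm_ge0 n (x : 'cV[R]_n) : 0 <= l2norm x.
Proof. exact: sqrtr_ge0. Qed.

Lemma sqr_l2norm n (x : 'cV[R]_n) : l2norm x ^+ 2 = \sum_i x i 0 ^+ 2.
Proof. by rewrite sqr_sqrtr // sumr_ge0 // => i _; exact: sqr_ge0. Qed.

Lemma le_l2norm m n (x : 'cV[R]_m) (y : 'cV[R]_n) :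
  \sum_i x i 0 ^+ 2 <= \sum_i y i 0 ^+ 2 -> l2norm x <= l2norm y.
Proof. exact: ler_wsqrtr. Qed.

Lemma le_coord_l2norm n (x : 'cV[R]_n) i : `|x i 0| <= l2norm x.
Proof.
rewrite -sqrtr_sqr ler_wsqrtr // (bigD1 i) //= lerDl sumr_ge0 // => k _.
exact: sqr_ge0.
Qed.

Lemma l2norm_eq0 n (x : 'cV[R]_n) : l2norm x = 0 -> x = 0.
Proof.
move=> x0; apply/matrixP => i j; rewrite ord1 mxE; apply: normr0_eq0; apply/eqP.
by rewrite eq_le normr_ge0 -x0 le_coord_l2norm.
Qed.

Lemma l2norm0 n : l2norm (0 : 'cV[R]_n) = 0.
Proof.
by rewrite /l2norm big1 ?sqrtr0 // => i _; rewrite mxE expr0n.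
Qed.

Lemma l2normZ n a (x : 'cV[R]_n) : l2norm (a *: x) = `|a| * l2norm x.
Proof.
rewrite -sqrtr_sqr -sqrtrM ?sqr_ge0 // mulr_sumr; congr Num.sqrt.
by apply: eq_bigr => i _; rewrite mxE exprMn.
Qed.

Lemma cauchy_schwarz n (x y : 'cV[R]_n) :
  \sum_i x i 0 * y i 0 <= l2norm x * l2norm y.
Proof.
have [/l2norm_eq0 ->|x0] := eqVneq (l2norm x) 0.
  by rewrite l2norm0 mul0r big1 // => i _; rewrite mxE mul0r.
have [/l2norm_eq0 ->|y0] := eqVneq (l2norm y) 0.
  by rewrite l2norm0 mulr0 big1 // => i _; rewrite mxE mulr0.
have ab0 : 0 < l2norm x * l2norm y.
  by rewrite mulr_gt0 // lt_neqAle eq_sym l2norm_ge0 ?x0 ?y0.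
(* With [a = l2norm x] and [b = l2norm y], this sum equals [2ab(ab - <x, y>)]; the zero cases were
   set aside so that [ab > 0] can be cancelled. *)
have : 0 <= \sum_i (l2norm y * x i 0 - l2norm x * y i 0) ^+ 2.
  by apply: sumr_ge0 => i _; exact: sqr_ge0.
set a := l2norm x in ab0 *; set b := l2norm y in ab0 *.
have -> : \sum_i (b * x i 0 - a * y i 0) ^+ 2 =
    b ^+ 2 * (\sum_i x i 0 ^+ 2) - 2 * (a * b) * (\sum_i x i 0 * y i 0)
    + a ^+ 2 * (\sum_i y i 0 ^+ 2).
  rewrite !mulr_sumr -sumrN -!big_split /=.
  by apply: eq_bigr => i _; ring.
rewrite -!sqr_l2norm -/a -/b.
move=> h; rewrite -(ler_pM2l ab0); nra.
Qed.

Lemma l2normD n (x y : 'cV[R]_n) : l2norm (x + y) <= l2norm x + l2norm y.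
Proof.
have h0 : 0 <= l2norm x + l2norm y by rewrite addr_ge0 ?l2norm_ge0.
rewrite -(@ler_pXn2r _ 2) ?nnegrE ?l2norm_ge0 // sqrrD !sqr_l2norm.
have -> : \sum_i (x + y) i 0 ^+ 2 = \sum_i x i 0 ^+ 2
    + (\sum_i x i 0 * y i 0) *+ 2 + \sum_i y i 0 ^+ 2.
  rewrite -sumrMnl -!big_split /=.
  by apply: eq_bigr => i _; rewrite mxE sqrrD.
by rewrite lerD2r lerD2l ler_pMn2r // cauchy_schwarz.
Qed.

Lemma l2norm_sum n (I : finType) (f : I -> 'cV[R]_n) :
  l2norm (\sum_i f i) <= \sum_i l2norm (f i).
Proof.
apply: (big_ind2 (fun x b => l2norm x <= b)) => //; first by rewrite l2norm0.
by move=> x b y c xb yc; apply: le_trans (l2normD _ _) (lerD xb yc).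
Qed.

Lemma l2norm_le_sum n (x : 'cV[R]_n) : l2norm x <= \sum_i `|x i 0|.
Proof.
rewrite -(@ler_pXn2r _ 2) ?nnegrE ?l2norm_ge0 ?sumr_ge0 // sqr_l2norm.
rewrite [leRHS]expr2 mulr_suml ler_sum // => i _.
rewrite -[leLHS]real_normK ?num_real // expr2 ler_wpM2l //.
by rewrite (bigD1 i) //= lerDl sumr_ge0.
Qed.

Lemma opnorm_ge0 m n (A : 'M[R]_(m, n)) : 0 <= opnorm A.
Proof.
apply: ub_le_sup; first by case: (opnorm_has_sup A).
by exists 0; rewrite /= ?mulmx0 l2norm0 ?ler01.
Qed.

Lemma l2norm_mulmx m n (A : 'M[R]_(m, n)) (x : 'cV[R]_n) :
  l2norm (A *m x) <= opnorm A * l2norm x.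
Proof.
have [/l2norm_eq0 ->|x0] := eqVneq (l2norm x) 0.
  by rewrite mulmx0 !l2norm0 mulr0.
have xgt0 : 0 < l2norm x by rewrite lt_neqAle eq_sym x0 l2norm_ge0.
rewrite -ler_pdivrMr //.
apply: ub_le_sup; first by case: (opnorm_has_sup A).
(* The supremum runs over the unit ball, so it is tested at the normalized vector. *)
exists ((l2norm x)^-1 *: x); rewrite /= -?scalemxAr l2normZ ger0_norm ?invr_ge0 ?l2norm_ge0 //.
  by rewrite mulVf.
by rewrite mulrC.
Qed.

(* [|A^T x|^2 = <x, A A^T x>], then Cauchy-Schwarz. *)
Lemma l2norm_trmulmx m n (A : 'M[R]_(m, n)) (x : 'cV[R]_m) :
  l2norm (A^T *m x) <= opnorm A * l2norm x.
Proof.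
set y := A^T *m x.
have [->|y0] := eqVneq (l2norm y) 0; first by rewrite mulr_ge0 ?opnorm_ge0 ?l2norm_ge0.
have ygt0 : 0 < l2norm y by rewrite lt_neqAle eq_sym y0 l2norm_ge0.
rewrite -(ler_pM2r ygt0) -expr2 sqr_l2norm.
have -> : \sum_i y i 0 ^+ 2 = \sum_i x i 0 * (A *m y) i 0.
  transitivity ((y^T *m y) 0 0).
    by rewrite mxE; apply: eq_bigr => i _; rewrite [y^T _ _]mxE expr2.
  rewrite {1}/y trmx_mul trmxK -mulmxA mxE.
  by apply: eq_bigr => i _; rewrite [x^T _ _]mxE.
apply: le_trans (cauchy_schwarz _ _) _.
rewrite [opnorm A * _]mulrC -mulrA ler_wpM2l ?l2norm_ge0 //.
exact: l2norm_mulmx.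
Qed.

End L2norm.

(** * The largest Euclidean norm of a row *)

Section RowNorm.
Variables (R : realType) (d n : nat).
Implicit Types M : 'M[R]_(d, n).

(** The operator norm from l^2 to l^oo. Rows are transposed because [l2norm] takes column vectors;
    the base value 0 is harmless, norms being nonnegative. *)
Definition rownorm M : R :=
  \big[Num.max/0]_(i < d) l2norm (row i M)^T.

Lemma rownorm_ge0 M : 0 <= rownorm M.
Proof. exact: bigmax_ge_id. Qed.

Lemma le_rownorm M i : l2norm (row i M)^T <= rownorm M.
Proof. exact: le_bigmax. Qed.

Lemma le_coord_rownorm M i j : `|M i j| <= rownorm M.
Proof.
apply: le_trans (le_rownorm M i).
by apply: le_trans (le_coord_l2norm _ j); rewrite !mxE.
Qed.

Lemma rownorm_le_sum M : rownorm M <= \sum_i \sum_j `|M i j|.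
Proof.
apply: bigmax_le => [|i _]; first by do 2!apply: sumr_ge0 => ? _.
apply: le_trans (l2norm_le_sum _) _.
rewrite [leRHS](bigD1 i) //= -[leLHS]addr0 lerD //.
  by apply: ler_sum => j _; rewrite !mxE.
by do 2!apply: sumr_ge0 => ? _.
Qed.

Lemma rownorm_mulmx (W : 'M[R]_d) M (A : 'M[R]_n) :
  rownorm (W *m M *m A) <= infnorm W * opnorm A * rownorm M.
Proof.
have W0 : 0 <= infnorm W by exact: bigmax_ge_id.
apply: bigmax_le => [|i _]; first by rewrite !mulr_ge0 ?opnorm_ge0 ?rownorm_ge0.
(* Transposing turns right multiplication by [A] into left multiplication by [A^T], where
   [l2norm_trmulmx] applies. *)
have -> : (row i (W *m M *m A))^T = A^T *m \sum_k W i k *: (row k M)^T.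
  rewrite row_mul trmx_mul row_mul; congr (_ *m _); apply/matrixP => a b.
  rewrite !mxE summxE; apply: eq_bigr => k _; rewrite !mxE //.
apply: le_trans (l2norm_trmulmx _ _) _.
rewrite [infnorm W * _]mulrC -mulrA ler_wpM2l ?opnorm_ge0 //.
apply: le_trans (l2norm_sum _) _.
apply: (@le_trans _ _ (\sum_k `|W i k| * rownorm M)).
  by apply: ler_sum => k _; rewrite l2normZ ler_wpM2l // le_rownorm.
by rewrite -mulr_suml ler_wpM2r ?rownorm_ge0 //; exact: le_bigmax.
Qed.

Lemma rownorm_map_nonexpansive (s : R -> R) M M' :
  nonexpansive s -> rownorm (map_mx s M - map_mx s M') <= rownorm (M - M').
Proof.
move=> s_nonexp; apply: bigmax_le => [|i _]; first exact: rownorm_ge0.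
apply: le_trans (le_rownorm _ i).
apply: le_l2norm; apply: ler_sum => j _; rewrite !mxE.
rewrite -[leLHS]real_normK ?num_real // -[leRHS]real_normK ?num_real //.
by rewrite lerXn2r ?nnegrE.
Qed.

End RowNorm.

(** * Geometric convergence and the fixed point of a contraction *)

Lemma is_cvg_geometric_step (R : realType) (u : R^nat) (a q : R) :
  0 <= q < 1 -> (forall k, `|u k.+1 - u k| <= a * q ^+ k) -> cvgn u.
Proof.
move=> /andP[q0 q1] hu.
(* The sequence is its first term plus the series of its steps, which converges absolutely by
   comparison with a geometric series. *)
have -> : u = (fun k => u 0%N + series (telescope u) k).
  by apply/funext => k; rewrite -eq_sum_telescope.
apply: is_cvgD; first exact: is_cvg_cst.
have ge_geo k : `|telescope u k| <= geometric a q k by exact: hu.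
apply: normed_cvg; apply: (series_le_cvg _ _ ge_geo) => //.
  by move=> k; exact: le_trans (normr_ge0 _) (ge_geo k).
by apply: is_cvg_geometric_series; rewrite ger0_norm.
Qed.

(* Banach's theorem for a distance on a set with finitely many real coordinates:
   [b] decodes the coordinates [c], and [D] is equivalent to the l^1 distance. *)
Lemma contraction_exists_unique_fixpoint (R : realType) (E : Type)
    (I : finType) (c : E -> I -> R) (b : (I -> R) -> E)
    (D : E -> E -> R) (C q : R) (F : E -> E) :
  cancel c b -> cancel b c ->
  (forall x y i, `|c x i - c y i| <= D x y) ->
  (forall x y, D x y <= C * \sum_i `|c x i - c y i|) ->
  0 <= q < 1 -> (forall x y, D (F x) (F y) <= q * D x y) ->
  exists! x, x = F x.
Proof.
move=> cK bK leD Dle q01 FD; have /andP[q0 q1] := q01.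
(* Picard iteration from an arbitrary point; its limit [L] is taken coordinate by coordinate and
   then decoded. *)
pose u k := iter k F (b (fun=> 0)).
have Du k : D (u k.+1) (u k) <= D (u 1%N) (u 0%N) * q ^+ k.
  elim: k => [|k ih]; first by rewrite expr0 mulr1.
  by rewrite exprS mulrCA (le_trans (FD _ _)) // ler_wpM2l.
have cvg_u i : cvgn (fun k => c (u k) i).
  by apply: (is_cvg_geometric_step q01) => k; exact: le_trans (leD _ _ _) (Du k).
pose L := b (fun i => limn (fun k => c (u k) i)).
have uL i : (fun k => c (u k) i) @ \oo --> c L i by rewrite /L bK; exact: cvg_u.
(* By [leD], [FD] and [Dle], this sequence bounds each coordinate difference of [u k.+1] and [F L];
   so [u k.+1] tends to [F L] as well as to [L]. *)
have uL0 : (fun k => q * (C * \sum_i `|c (u k) i - c L i|)) @ \oo --> (0 : R).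
  rewrite -[X in _ --> X](mulr0 q); apply: cvgMl_tmp.
  rewrite -[X in _ --> X](mulr0 C); apply: cvgMl_tmp.
  suff : (fun k => \sum_i `|c (u k) i - c L i|) @ \oo --> \sum_(i : I) (0 : R).
    by rewrite big1.
  apply: cvg_big => [|i _]; first exact: add_continuous.
  by apply/norm_cvg0P/subr_cvg0; exact: uL.
have FL : L = F L.
  apply: (can_inj cK); apply/funext => i.
  have h1 : (fun k => c (u k.+1) i) @ \oo --> c L i.
    by rewrite (cvg_shiftS (fun k => c (u k) i)).
  apply: (cvg_unique _ h1) => //.
  apply/subr_cvg0/norm_cvg0P.
  apply: (squeeze_cvgr _ _ uL0); last exact: cvg_cst.
  apply: nearW => k; rewrite normr_ge0 /=.
  by rewrite (le_trans (leD _ _ _)) // (le_trans (FD _ _)) // ler_wpM2l.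
exists L; split=> // y yF.
apply: (can_inj cK); apply/funext => i; apply/eqP.
rewrite -subr_eq0 -normr_le0 (le_trans (leD _ _ _)) //.
(* For two fixed points, [D L y <= q * D L y] with [q < 1] gives [D L y <= 0], and [D] bounds every
   coordinate difference. *)
have := FD L y; rewrite -FL -yF -subr_le0 -{1}[D L y]mul1r -mulrBl.
by rewrite pmulr_rle0 // subr_gt0.
Qed.

(** * The equilibrium system as a fixed point equation *)

Theorem mainTheorem2 (R : realType) (N T n d l : nat)
    (N_ge1 : (1 <= N)%N) (T_ge1 : (1 <= T)%N) (n_ge1 : (1 <= n)%N)
    (d_ge1 : (1 <= d)%N) (l_ge1 : (1 <= l)%N)
    (A : 'I_N -> 'I_T -> 'M[R]_n) (X : 'I_N -> 'I_T -> 'M[R]_(l, n))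
    (W : 'I_T -> 'M[R]_d) (V : 'M[R]_(d, l))
    (s : R -> R) (s_nonexp : nonexpansive s)
    (contr : forall (t : 'I_T) (i : 'I_N),
       infnorm (W t) * opnorm (A i t) < 1) :
  forall i : 'I_N,
    exists! Z : {ffun 'I_T -> 'M[R]_(d, n)}, equilibrium s W V (A i) (X i) Z.
Proof.
move=> i.
pose q := \big[Num.max/0]_t (infnorm (W t) * opnorm (A i t)).
pose c (Z : {ffun 'I_T -> 'M[R]_(d, n)}) (p : 'I_T * ('I_d * 'I_n)) :=
  Z p.1 p.2.1 p.2.2.
pose b (x : 'I_T * ('I_d * 'I_n) -> R) : {ffun 'I_T -> 'M[R]_(d, n)} :=
  [ffun t => \matrix_(j, k) x (t, (j, k))].
pose D (Z Z' : {ffun 'I_T -> 'M[R]_(d, n)}) :=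
  \big[Num.max/0]_t rownorm (Z t - Z' t).
pose F (Z : {ffun 'I_T -> 'M[R]_(d, n)}) : {ffun 'I_T -> 'M[R]_(d, n)} :=
  [ffun t => map_mx s (W t *m Z (tau t) *m A i t + V *m X i t)].
have equilE Z : equilibrium s W V (A i) (X i) Z <-> Z = F Z.
  split=> [eqZ|eqZ t]; first by apply/ffunP => t; rewrite ffunE.
  by rewrite [in LHS]eqZ ffunE.
have D_ge0 Z Z' : 0 <= D Z Z' by exact: bigmax_ge_id.
have q_ge0 : 0 <= q by exact: bigmax_ge_id.
(* The constant 1 works since a row norm is at most the sum of all absolute entries of its matrix,
   hence of the whole family. *)
have [||||||Z [FZ Zuniq]] :=
  @contraction_exists_unique_fixpoint R _ _ c b D 1 q F.
- by move=> Z; apply/ffunP => t; rewrite ffunE; apply/matrixP => j k; rewrite mxE.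
- by move=> x; apply/funext => -[t [j k]]; rewrite /c ffunE mxE.
- move=> Z Z' [t [j k]]; apply: le_trans (le_bigmax _ _ t).
  by apply: le_trans (le_coord_rownorm _ j k); rewrite !mxE.
- move=> Z Z'; rewrite mul1r; apply: bigmax_le => [|t _].
    by apply: sumr_ge0 => p _.
  rewrite -(pair_bigA _ (fun t p => `|c Z (t, p) - c Z' (t, p)|)) /=.
  rewrite (bigD1 t) //= -[leLHS]addr0 lerD //; last first.
    by apply: sumr_ge0 => t' _; apply: sumr_ge0.
  rewrite -(pair_bigA _ (fun j k => `|c Z (t, (j, k)) - c Z' (t, (j, k))|)) /=.
  apply: le_trans (rownorm_le_sum _) _.
  by apply: ler_sum => j _; apply: ler_sum => k _; rewrite !mxE.
(* A finite maximum of numbers below 1 stays below 1, as does its base value 0. *)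
- by rewrite q_ge0 /=; apply: bigmax_lt => [|t _]; rewrite ?ltr01.
- move=> Z Z'; apply: bigmax_le => [|t _]; first by rewrite mulr_ge0.
  rewrite !ffunE; apply: le_trans (rownorm_map_nonexpansive _ _ s_nonexp) _.
  (* The term [V *m X i t] cancels in the difference. *)
  rewrite opprD addrACA subrr addr0 -mulmxBl -mulmxBr.
  apply: le_trans (rownorm_mulmx _ _ _) _.
  apply: ler_pM; rewrite ?rownorm_ge0 ?mulr_ge0 ?opnorm_ge0 //.
  + exact: bigmax_ge_id.
  + exact: le_bigmax.
  (* The component at [tau t] is itself one of those over which [D] takes its maximum. *)
  + exact: (le_bigmax _ _ (tau t)).
exists Z; split=> [|Z' /equilE]; last exact: Zuniq.
exact/equilE.
Qed.
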